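(* Let $k\ge 3$ and $p=1+k+k(k-1)/2$. In the $k$-dimensional Poisson regression model with first-order interactions, let $\boldsymbol{\beta}$ have $\beta_0=0$, $\beta_1=\dots=\beta_k=-1$ and $\beta_{ij}=0$ for all $1\le i<j\le k$. Let $\mathbf{x}_0=(0,\dots,0)$, let $\mathbf{x}_i=2\mathbf{e}_i$ for $i=1,\dots,k$ (where $\mathbf{e}_i$ is the $i$-th unit vector), and let $\mathbf{x}_{ij}=\mathbf{x}_i+\mathbf{x}_j$ for $1\le i<j\le k$. Then the design which assigns equal weights $1/p$ to these $p$ settings is locally $D$-optimal at $\boldsymbol{\beta}$ on $\mathcal{X}=[0,\infty)^k$.
   Context: In the $k$-dimensional Poisson regression model with first-order interactions, an observation at $\mathbf{x}=(x_1,\dots,x_k)$ is Poisson distributed with mean $\lambda(\mathbf{x})=\exp(\mathbf{f}(\mathbf{x})^\top\boldsymbol{\beta})$, where $\mathbf{f}(\mathbf{x})=(1,x_1,\dots,x_k,(x_ix_j)_{1\le i<j\le k})^\top$, so $\mathbf{f}(\mathbf{x})^\top\boldsymbol{\beta}=\beta_0+\sum_j\beta_jx_j+\sum_{i<j}\beta_{ij}x_ix_j$. A design $\xi$ is a finite collection of distinct settings $\mathbf{x}_i\in\mathcal{X}$ with weights $w_i\ge0$ summing to $1$; its information matrix is $\mathbf{M}_{\boldsymbol{\beta}}(\xi)=\sum_i w_i\lambda(\mathbf{x}_i)\mathbf{f}(\mathbf{x}_i)\mathbf{f}(\mathbf{x}_i)^\top$. A design is locally $D$-optimal at $\boldsymbol{\beta}$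 on $\mathcal{X}$ if it maximizes $\det\mathbf{M}_{\boldsymbol{\beta}}(\xi)$ over all designs on $\mathcal{X}$. *)

(* Defs.v *)
From HB Require Import structures.
From mathcomp Require Import all_boot all_order all_algebra.
From mathcomp Require Import reals sequences exp.
Set Implicit Arguments. Unset Strict Implicit. Unset Printing Implicit Defensive.
Import Order.TTheory GRing.Theory Num.Theory.
Local Open Scope ring_scope.

(* Index set of the regression functions f(x) = (1, x_1..x_k, (x_i x_j)_{i<j}):
   inl (inl tt)  : intercept
   inl (inr i)   : main effect x_i
   inr ij        : interaction x_i x_j with i < j. *)
Definition pairlt (k : nat) := {ij : 'I_k * 'I_k | (ij.1 < ij.2)%N}.
Definition idx (k : nat) : finType := ((unit + 'I_k) + pairlt k)%type.

Definition npar (k : nat) : nat := #|idx k|.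

Definition feat {R : realType} (k : nat) (x : 'rV[R]_k) (t : idx k) : R :=
  match t with
  | inl (inl _) => 1
  | inl (inr i) => x ord0 i
  | inr ij => x ord0 (sval ij).1 * x ord0 (sval ij).2
  end.

Definition fvec {R : realType} (k : nat) (x : 'rV[R]_k) : 'rV[R]_(npar k) :=
  \row_(j < npar k) feat x (enum_val j).

Definition lam {R : realType} (k : nat) (beta : 'rV[R]_(npar k)) (x : 'rV[R]_k) : R :=
  expR (\sum_(j < npar k) fvec x ord0 j * beta ord0 j).

Definition in_domain {R : realType} (k : nat) (x : 'rV[R]_k) : Prop :=
  forall i : 'I_k, 0 <= x ord0 i.

Definition is_design {R : realType} (k n : nat) (X : 'I_n -> 'rV[R]_k) (w : 'I_n -> R) : Prop :=
  injective X /\ (forall i, in_domain (X i)) /\ (forall i, 0 <= w i) /\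
  \sum_(i < n) w i = 1.

Definition infomat {R : realType} (k : nat) (beta : 'rV[R]_(npar k)) (n : nat)
  (X : 'I_n -> 'rV[R]_k) (w : 'I_n -> R) : 'M[R]_(npar k) :=
  \sum_(i < n) (w i * lam beta (X i)) *: ((fvec (X i))^T *m fvec (X i)).

Definition locally_D_optimal {R : realType} (k : nat) (beta : 'rV[R]_(npar k)) (n : nat)
  (X : 'I_n -> 'rV[R]_k) (w : 'I_n -> R) : Prop :=
  is_design X w /\
  forall (m : nat) (Y : 'I_m -> 'rV[R]_k) (v : 'I_m -> R),
    is_design Y v -> \det (infomat beta Y v) <= \det (infomat beta X w).

Definition beta_coef {R : realType} (k : nat) (t : idx k) : R :=
  match t with
  | inl (inl _) => 0
  | inl (inr _) => -1
  | inr _ => 0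
  end.
Definition beta5 {R : realType} (k : nat) : 'rV[R]_(npar k) :=
  \row_(j < npar k) beta_coef (enum_val j).

Definition unitv {R : realType} (k : nat) (i : 'I_k) : 'rV[R]_k :=
  \row_(l < k) (if l == i then 1 else 0).
Definition setting {R : realType} (k : nat) (t : idx k) : 'rV[R]_k :=
  match t with
  | inl (inl _) => 0
  | inl (inr i) => 2 *: unitv (R:=R) i
  | inr ij => 2 *: unitv (R:=R) (sval ij).1 + 2 *: unitv (R:=R) (sval ij).2
  end.
Definition X5 {R : realType} (k : nat) (j : 'I_(npar k)) : 'rV[R]_k :=
  setting (R:=R) (enum_val j).
Definition w5 {R : realType} (k : nat) (j : 'I_(npar k)) : R := (npar k)%:R^-1.

(* Main.v *)
Require Import Defs.
From mathcomp Require Import all_boot all_order all_algebra.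
From mathcomp Require Import ring lra zify.
From mathcomp Require Import all_classical.
From mathcomp Require Import reals topology function_spaces normedtype.
From mathcomp Require Import realfun derive sequences exp.
Set Implicit Arguments. Unset Strict Implicit. Unset Printing Implicit Defensive.
Import Order.TTheory GRing.Theory Num.Theory.
Import numFieldNormedType.Exports.
Local Open Scope ring_scope.

(** The design is saturated, so in the Lagrange basis [l_t] of its p support
    points its information matrix is diagonal with entries [lam_t / p].  For a
    competing design, Hadamard's inequality bounds the determinant of its
    matrix in the same basis by the product of the diagonal entries, and by
    AM-GM optimality follows once
      [lam x * \sum_t l_t x ^ 2 / lam_t <= 1]  for all x >= 0.
    With u = x / 2 and S = \sum_i u_i this says that
      (1 - S + E_2)^2 + e^2 \sum_i u_i^2 (1 - S + u_i)^2
        + e^4 \sum_{i<j} u_i^2 u_j^2  <=  exp (2 S),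
    where E_2 = \sum_{i<j} u_i u_j.  Fix S and maximise the left side over the
    simplex.  When only u_i and u_j move, with constant sum, it is a quadratic
    in u_i u_j with leading coefficient (1 + e^2)^2 > 0; hence at a
    maximum any two nonzero coordinates are equal.  It remains to treat m coordinates equal to a: m = 1 is an
    elementary inequality, m = 2 is its square, and for m >= 3 there is enough
    room to compare with the Taylor polynomial of exp of degree 7. *)

(** * Exponential estimates for points with equal nonzero coordinates *)

Section ScalarBounds.
Variable R : realType.
Implicit Types x a s t : R.

Lemma series_exp_coeff_le x n : 0 <= x -> series (exp_coeff x) n <= expR x.
Proof.
move=> x0; apply: nondecreasing_cvgn_le; last exact: is_cvg_series_exp_coeff.
by apply: nondecreasing_series => i _ _; exact: exp_coeff_ge0.
Qed.

Lemma expR_ge_taylor7 x : 0 <= x ->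
  1 + x + x ^+ 2 / 2 + x ^+ 3 / 6 + x ^+ 4 / 24 + x ^+ 5 / 120
    + x ^+ 6 / 720 + x ^+ 7 / 5040 <= expR x.
Proof.
move=> /(series_exp_coeff_le 8); apply: le_trans.
rewrite /series/= /exp_coeff !big_nat_recr//= big_nil.
rewrite !factS fact0 !natrM; lra.
Qed.

Lemma expR1_ge2 : 2 <= expR 1 :> R.
Proof. by have := expR_ge1Dx (1 : R); lra. Qed.

Lemma expR1_le : expR 1 <= 11 / 4 :> R.
Proof.
(* Starting from [1 - 1 / 64 <= expR (- 64^-1)], six squarings reach the exponent -1; each result is
   rounded down to a simple fraction, the last one being 4 / 11. *)
have sq (y c d : R) : 0 <= c -> d <= c ^+ 2 -> c <= expR (- y) -> d <= expR (- (2 * y)).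
  move=> c0 dc cy; apply: le_trans dc _.
  by rewrite -mulrN expRM_natl lerXn2r ?nnegrE ?expR_ge0.
have h : 63 / 64 <= expR (- 64^-1) :> R.
  by have := expR_ge1Dx (- 64^-1 : R); lra.
have {}h : 125 / 129 <= expR (- (2 * 64^-1)) :> R by apply: sq h; lra.
have {}h : 123 / 131 <= expR (- (2 * (2 * 64^-1))) :> R by apply: sq h; lra.
have {}h : 67 / 76 <= expR (- (2 * (2 * (2 * 64^-1)))) :> R by apply: sq h; lra.
have {}h : 143 / 184 <= expR (- (2 * (2 * (2 * (2 * 64^-1))))) :> R by apply: sq h; lra.
have {}h : 61 / 101 <= expR (- (2 * (2 * (2 * (2 * (2 * 64^-1)))))) :> R by apply: sq h; lra.
have {}h : 4 / 11 <= expR (- 1) :> R.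
  have -> : 1 = 2 * (2 * (2 * (2 * (2 * (2 * 64^-1))))) :> R by lra.
  by apply: sq h; lra.
have := expRxMexpNx_1 (1 : R); have := expR_gt0 (1 : R); nra.
Qed.

(** Equality holds at a = 0 and a = 1. The difference of squares e^(2a) - e^2 a^2 is factored. Near
    0 linear bounds of the factors suffice; for a > 1 / 2 the first factor is bounded by a multiple
    of (a - 1)^2, which keeps the double zero at 1. *)
Lemma one_factor_bound a : 0 <= a ->
  (1 - a) ^+ 2 + expR 1 ^+ 2 * a ^+ 2 <= expR a ^+ 2.
Proof.
move=> a0; have e2 := expR1_ge2; have e3 := expR1_le; have ea := expR_ge1Dx a.
set e := expR 1 in e2 e3 *.
have -> : expR a ^+ 2 = e ^+ 2 * a ^+ 2 + (expR a - e * a) * (expR a + e * a) by ring.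
rewrite addrC lerD2l.
have [ha|ha] := leP a 2^-1.
  have h1 : 1 - 7 / 4 * a <= expR a - e * a by nra.
  have h2 : 1 + 3 * a <= expR a + e * a by nra.
  by apply: (@le_trans _ _ ((1 - 7 / 4 * a) * (1 + 3 * a))); [nra|apply: ler_pM; lra].
have h1 : e * ((a - 1) ^+ 2 / 4) <= expR a - e * a.
  (* Squaring e^((a - 1) / 2) >= 1 + (a - 1) / 2 gives e^(a - 1) >= a + (a - 1)^2 / 4. *)
  have -> : expR a = e * expR ((a - 1) / 2) ^+ 2.
    rewrite -expRM_natl -expRD; congr expR; lra.
  rewrite -mulrBr ler_wpM2l//; first by lra.
  by have := expR_ge1Dx ((a - 1) / 2); nra.
have h2 : 1 + 3 * a <= expR a + e * a by nra.
apply: (@le_trans _ _ ((e * ((a - 1) ^+ 2 / 4)) * (1 + 3 * a))).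
  rewrite -subr_ge0.
  have -> : e * ((a - 1) ^+ 2 / 4) * (1 + 3 * a) - (1 - a) ^+ 2 =
    (1 - a) ^+ 2 * (e * (1 + 3 * a) / 4 - 1) by field.
  by rewrite mulr_ge0 ?sqr_ge0//; nra.
by apply: ler_pM => //; [rewrite mulr_ge0 ?divr_ge0 ?sqr_ge0 ?expR_ge0|lra].
Qed.

(* With [t = 1 / m <= 1 / 3] the numbers 1 and 2 / 3 are the extreme values of
   [1 - t]; [38 / 15] and [15 / 7] are upper bounds of [e^2 / 3] and
   [e^4 / 27]. *)
Lemma taylor7_bound (w s : R) : w = 1 \/ w = 2 / 3 -> 0 <= s ->
  (1 - s + s ^+ 2 / 2) ^+ 2 + 38 / 15 * s ^+ 2 * (1 - w * s) ^+ 2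
    + 15 / 7 * s ^+ 4 <= expR (2 * s).
Proof.
move=> hw s0; apply: le_trans (expR_ge_taylor7 _); last lra.
(* In the difference only s^2 and s^4 have negative coefficients; up to 3 / 2 the terms in s and s^3
   absorb them. *)
have [hs|hs] := leP s (3 / 2).
  have h3 : 0 <= s ^+ 3 * (3 / 2 - s) by rewrite mulr_ge0 ?exprn_ge0// subr_ge0.
  have h1 : 0 <= s * (3 / 2 - s) by rewrite mulr_ge0// subr_ge0.
  have h5 := exprn_ge0 5 s0; have h6 := exprn_ge0 6 s0; have h7 := exprn_ge0 7 s0.
  have h4 := exprn_ge0 4 s0; have h3' := exprn_ge0 3 s0.
  by case: hw => ->; lra.
have [y ys y0] : exists2 y, s = 3 / 2 + y & 0 <= y by exists (s - 3 / 2); lra.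
rewrite {s s0 hs}ys.
(* After the shift, [y1] and [y2] absorb the negative coefficients of [y] and
   [y ^ 2]. *)
have y1 : 0 <= (y - 3 / 4) ^+ 2 * (y + 3 / 2) by rewrite mulr_ge0 ?sqr_ge0//; lra.
have y2 := sqr_ge0 (y ^+ 2 - 1).
have z1 : 0 <= y * ((y - 3 / 4) ^+ 2 * (y + 3 / 2)) by exact: mulr_ge0.
have z2 : 0 <= y * (y ^+ 2 - 1) ^+ 2 by exact: mulr_ge0.
have h2 := exprn_ge0 2 y0; have h3 := exprn_ge0 3 y0; have h4 := exprn_ge0 4 y0.
have h5 := exprn_ge0 5 y0; have h6 := exprn_ge0 6 y0; have h7 := exprn_ge0 7 y0.
by case: hw => ->; lra.
Qed.

(** Here s = m a and t = 1 / m. A real t in [0, 1 / 3] covers all m >= 3 at once, and each term is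
    bounded separately over this range. *)
Lemma equal_coordinates_bound_ge3 (t s : R) : 0 <= t <= 1 / 3 -> 0 <= s ->
  (1 - s + s ^+ 2 * (1 - t) / 2) ^+ 2 + expR 1 ^+ 2 * (s ^+ 2 * t * (1 - s + t * s) ^+ 2)
   + expR 1 ^+ 4 * (s ^+ 4 * (t ^+ 2 * (1 - t)) / 2) <= expR (2 * s).
Proof.
move=> /andP[t0 t3] s0; have e2 := expR1_ge2; have e3 := expR1_le.
set e := expR 1 in e2 e3 *.
have E2 : e ^+ 2 <= 38 / 5 by nra.
have E4 : e ^+ 4 <= 405 / 7.
  have e0 := sqr_ge0 e.
  by rewrite (exprM e 2 2); apply: (@le_trans _ _ ((38 / 5) ^+ 2)); [rewrite lerXn2r ?nnegrE|]; lra.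
have T0 : (1 - s + s ^+ 2 * (1 - t) / 2) ^+ 2 <= (1 - s + s ^+ 2 / 2) ^+ 2.
  have h : 0 <= s ^+ 2 * t by rewrite mulr_ge0 ?sqr_ge0.
  have h' : 0 <= s ^+ 2 * (1 / 3 - t) by rewrite mulr_ge0 ?sqr_ge0 ?subr_ge0.
  (* The smaller base is nonnegative: 1 - s + s^2 / 3 = (s - 3 / 2)^2 / 3 + 1 / 4. *)
  have h'' := sqr_ge0 (s - 3 / 2).
  by rewrite lerXn2r ?nnegrE//; lra.
(* [1 - s + t s] lies between [1 - s] and [1 - 2 s / 3]. *)
have [w hw T1] : exists2 w : R, w = 1 \/ w = 2 / 3 &
    (1 - s + t * s) ^+ 2 <= (1 - w * s) ^+ 2.
  have ts : 0 <= t * s <= 1 / 3 * s by rewrite mulr_ge0//= ler_wpM2r.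
  have [h|h] := leP 0 (1 - s + t * s).
    exists (2 / 3); first by right.
    by rewrite lerXn2r ?nnegrE//; lra.
  exists 1; first by left.
  by rewrite -[leLHS]sqrrN -[leRHS]sqrrN lerXn2r ?nnegrE//; lra.
have T2 : t ^+ 2 * (1 - t) <= 2 / 27.
  (* This product is 2 / 27 - t^2 (1 - t), with its root at the maximiser t = 1 / 3. *)
  have : 0 <= (1 / 3 - t) * (2 / 9 + 2 / 3 * t - t ^+ 2) by rewrite mulr_ge0 //; nra.
  lra.
apply: le_trans (taylor7_bound hw s0); rewrite -addrA -[leRHS]addrA.
apply: lerD => //; apply: lerD.
  have -> : 38 / 15 * s ^+ 2 * (1 - w * s) ^+ 2 = 38 / 5 * (s ^+ 2 * (1 / 3) * (1 - w * s) ^+ 2) by lra.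
  apply: ler_pM => //; rewrite ?(sqr_ge0, mulr_ge0)//.
  by apply: ler_pM => //; rewrite ?(sqr_ge0, mulr_ge0)// ler_wpM2l// sqr_ge0.
have -> : 15 / 7 * s ^+ 4 = 405 / 7 * (s ^+ 4 * (2 / 27) / 2) by lra.
have s4 := exprn_ge0 4 s0.
apply: ler_pM => //; rewrite ?exprn_ge0 ?expR_ge0//.
  by rewrite !mulr_ge0 ?invr_ge0 ?sqr_ge0//; lra.
by rewrite ler_pM2r ?invr_gt0//; exact: ler_wpM2l.
Qed.

(* The left side of the key inequality in terms of power sums of u. *)
Definition sensitivity_poly (s p2 p3 p4 : R) : R :=
  (1 - s + (s ^+ 2 - p2) / 2) ^+ 2
  + expR 1 ^+ 2 * ((1 - s) ^+ 2 * p2 + 2 * (1 - s) * p3 + p4)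
  + expR 1 ^+ 4 * ((p2 ^+ 2 - p4) / 2).

Lemma sensitivity_poly_equal_coordinates (m : nat) a : 0 <= a ->
  sensitivity_poly (m%:R * a) (m%:R * a ^+ 2) (m%:R * a ^+ 3) (m%:R * a ^+ 4)
    <= expR (2 * (m%:R * a)).
Proof.
move=> a0; have one := one_factor_bound a0; rewrite /sensitivity_poly.
case: m => [|[|[|m]]].
- by rewrite !mul0r mulr0 expR0; lra.
- rewrite !mul1r (expRM_natl 2).
  by apply: le_trans one; rewrite le_eqVlt; apply/orP; left; apply/eqP; field.
- have -> : 2 * (2 * a) = 4 * a by ring.
  rewrite (expRM_natl 4) (exprM (expR a) 2 2).
  apply: (@le_trans _ _ (((1 - a) ^+ 2 + expR 1 ^+ 2 * a ^+ 2) ^+ 2)).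
    by rewrite le_eqVlt; apply/orP; left; apply/eqP; field.
  by rewrite lerXn2r ?nnegrE// ?addr_ge0 ?(sqr_ge0, mulr_ge0).
set n := m.+3%:R : R; have n3 : 3 <= n by rewrite ler_nat.
have n0 : n != 0 by rewrite gt_eqF//; lra.
have tn : 0 <= n^-1 <= 1 / 3.
  by rewrite invr_ge0 ler0n/= div1r lef_pV2 ?posrE ?ltr0n.
have s0 : 0 <= n * a by rewrite mulr_ge0// ler0n.
apply: le_trans (equal_coordinates_bound_ge3 tn s0); rewrite le_eqVlt; apply/orP; left; apply/eqP.
by clearbody n; field.
Qed.
End ScalarBounds.

(** * Maximising the sensitivity over a simplex *)

Section Simplex.
Local Open Scope classical_set_scope.
Variable R : realType.
Implicit Types a b : R.

Definition psum k (n : nat) (u : 'rV[R]_k) : R := \sum_i u ord0 i ^+ n.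

Definition sens k (u : 'rV[R]_k) : R :=
  sensitivity_poly (psum 1 u) (psum 2 u) (psum 3 u) (psum 4 u).

(** For fixed x + y, [F] is a quadratic q in the product x y. With v = a b and w = (a + b)^2 / 4,
    interpolation gives (w - v) q(0) + v q(w) - w q(v) = (1 + e^2)^2 v w (w - v). If a and b differ
    this is positive, so q(v) cannot dominate both q(0) and q(w). *)
Lemma sensitivity_poly_pair (r1 r2 r3 r4 a b : R) : 0 < a -> 0 < b ->
  let F x y := sensitivity_poly (r1 + (x ^+ 1 + y ^+ 1)) (r2 + (x ^+ 2 + y ^+ 2))
                 (r3 + (x ^+ 3 + y ^+ 3)) (r4 + (x ^+ 4 + y ^+ 4)) in
  F (a + b) 0 <= F a b -> F ((a + b) / 2) ((a + b) / 2) <= F a b -> a = b.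
Proof.
move=> a0 b0 F le1 le2; apply/eqP/negP => /negP ab.
pose v := a * b; pose w := (a + b) ^+ 2 / 4.
have v0 : 0 < v by exact: mulr_gt0.
have wv : 0 < w - v.
  have -> : w - v = (a - b) ^+ 2 / 4 by rewrite /w /v; field.
  by rewrite divr_gt0// lt0r sqr_ge0 sqrf_eq0 subr_eq0 ab.
have w0 : 0 < w by lra.
have : 0 < (1 + expR 1 ^+ 2) ^+ 2 * (v * w * (w - v)).
  apply: mulr_gt0; last exact: mulr_gt0 (mulr_gt0 v0 w0) wv.
  by rewrite exprn_gt0// addr_gt0// exprn_gt0// expR_gt0.
have -> : (1 + expR 1 ^+ 2) ^+ 2 * (v * w * (w - v)) =
    (w - v) * F (a + b) 0 + v * F ((a + b) / 2) ((a + b) / 2) - w * F a b.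
  by rewrite /w /v /F /sensitivity_poly; field.
apply/negP; rewrite -leNgt subr_le0.
have -> : w * F a b = (w - v) * F a b + v * F a b by ring.
by rewrite lerD// ler_wpM2l// ltW.
Qed.

Definition upd k (u : 'rV[R]_k) (i j : 'I_k) a b : 'rV[R]_k :=
  \row_l (if l == i then a else if l == j then b else u ord0 l).

Lemma upd_id k (u : 'rV[R]_k) i j : upd u i j (u ord0 i) (u ord0 j) = u.
Proof. by apply/rowP => l; rewrite mxE; case: eqP => [->//|_]; case: eqP => [->|]. Qed.

Lemma psum_upd k n (u : 'rV[R]_k) i j a b : i != j ->
  psum n (upd u i j a b) =
  \sum_(l | (l != i) && (l != j)) u ord0 l ^+ n + (a ^+ n + b ^+ n).
Proof.
move=> ij; rewrite /psum (bigD1 i)//= (bigD1 j)/=; last by rewrite eq_sym.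
rewrite !mxE eqxx eq_sym (negPf ij) eqxx addrA addrC; congr (_ + _).
by apply: eq_bigr => l /andP[/negPf li /negPf lj]; rewrite mxE li lj.
Qed.

Lemma continuous_psum k n : continuous (@psum k n).
Proof.
move=> u; rewrite /psum; apply: cvg_big => [| |i _]; first exact: add_continuous.
  exact: nbhs_filter.
apply: (@continuous_comp _ _ _ (fun v : 'rV[R]_k => v ord0 i) (@GRing.exp R ^~ n)).
  exact: coord_continuous.
exact: exprn_continuous.
Qed.

Lemma continuous_sens k : continuous (@sens k).
Proof.
move=> u; rewrite /sens /sensitivity_poly.
have p n : psum n v @[v --> u] --> psum n u by exact: continuous_psum.
have cvgX (f : 'rV[R]_k -> R) n (l : R) : f v @[v --> u] --> l -> f v ^+ n @[v --> u] --> l ^+ n.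
  by move=> h; apply: (@cvg_comp _ _ _ f (@GRing.exp R ^~ n) _ _ _ h); exact: exprn_continuous.
have FF : ProperFilter (nbhs u) by exact: nbhs_pfilter.
have p1B : 1 - psum 1 v @[v --> u] --> 1 - psum 1 u.
  by apply: cvgB; [exact: cvg_cst|exact: p].
apply: cvgD.
  apply: cvgD; last apply: cvgMl_tmp.
    apply: (cvgX _ _ _); apply: cvgD => //; apply: cvgMr_tmp.
    by apply: cvgB; [apply: (cvgX _ _ _); exact: p|exact: p].
  apply: cvgD; last exact: p.
  apply: cvgD.
    by apply: cvgM; [exact: cvgX|exact: p].
  apply: cvgM; last exact: p.
  by apply: cvgMl_tmp.
apply: cvgMl_tmp; apply: cvgMr_tmp.
by apply: cvgB; [apply: (cvgX _ _ _); exact: p|exact: p].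
Qed.

Lemma sens_le k (u : 'rV[R]_k) : (forall i, 0 <= u ord0 i) ->
  sens u <= expR (2 * psum 1 u).
Proof.
move=> u0; set s := psum 1 u.
(* The simplex is a box cut by a level set of the continuous [psum 1], hence compact. *)
pose K := [set v : 'rV[R]_k | (forall i, `[0, s]%classic (v ord0 i)) /\ psum 1 v = s].
have cK : compact K.
  apply: compact_closedI.
    by apply: (@rV_compact R k (fun=> `[0, s]%classic)) => i; exact: segment_compact.
  exact: (proj1 (continuous_closedP _) (@continuous_psum k 1%N) _ (@closed_eq _ s)).
have inK (v : 'rV[R]_k) : (forall i, 0 <= v ord0 i) -> psum 1 v = s -> K v.
  move=> v0 vs; split=> // i /=; rewrite in_itv/= v0 -vs /psum (bigD1 i)//= expr1 lerDl.
  by apply: sumr_ge0 => j _; rewrite expr1.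
have [v] : exists2 c : 'rV[R]_k, c \in K & forall t : 'rV[R]_k, t \in K -> sens t <= sens c.
  apply: EVT_max_rV => //; first by exists u; exact: inK.
  by apply: continuous_subspaceT; exact: continuous_sens.
rewrite inE => -[v01 vs] vmax.
have v0 i : 0 <= v ord0 i by have := v01 i; rewrite /= in_itv/= => /andP[].
apply: le_trans (vmax u _) _; first by rewrite inE; exact: inK.
have veq i j : v ord0 i != 0 -> v ord0 j != 0 -> v ord0 i = v ord0 j.
  move=> vi vj; have [->//|ij] := eqVneq i j.
  (* The maximiser is written as an update of itself, so that [psum_upd] splits both sides alike. *)
  have updK a b : 0 <= a -> 0 <= b -> a + b = v ord0 i + v ord0 j ->
      sens (upd v i j a b) <= sens (upd v i j (v ord0 i) (v ord0 j)).
    move=> a0 b0 ab; rewrite upd_id; apply: vmax; rewrite inE; apply: inK.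
      by move=> l; rewrite mxE; case: ifP => // _; case: ifP.
    rewrite -vs -[in RHS](upd_id v i j) !psum_upd// !expr1 ab//.
  have vi0 : 0 < v ord0 i by rewrite lt0r vi v0.
  have vj0 : 0 < v ord0 j by rewrite lt0r vj v0.
  have h1 := updK (v ord0 i + v ord0 j) 0 (addr_ge0 (v0 i) (v0 j)) (lexx 0) (addr0 _).
  have h2 := updK ((v ord0 i + v ord0 j) / 2) ((v ord0 i + v ord0 j) / 2).
  move: h1 h2; rewrite /sens !psum_upd// => h1 h2.
  by apply: (sensitivity_poly_pair vi0 vj0 h1); apply: h2; lra.
(* If all coordinates vanish, the count of nonzero ones is 0 and a = 0 serves. *)
have [a a0 va] : exists2 a, 0 <= a & forall i, v ord0 i != 0 -> v ord0 i = a.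
  have [/existsP[i vi]|/existsPn vn] := boolP [exists i, v ord0 i != 0].
    by exists (v ord0 i) => // j vj; exact: veq.
  by exists 0 => // i vi; have := vn i; rewrite vi.
(* A positive exponent makes the zero coordinates contribute nothing. *)
have pE n : psum n.+1 v = #|[pred i | v ord0 i != 0]|%:R * a ^+ n.+1.
  rewrite /psum (bigID (fun i => v ord0 i != 0))/= [X in _ + X]big1 ?addr0.
    rewrite (eq_bigr (fun=> a ^+ n.+1)) => [|i /va->//].
    by rewrite sumr_const mulr_natl.
  by move=> i /negPn/eqP ->; rewrite expr0n.
rewrite -vs /sens !pE expr1; exact: sensitivity_poly_equal_coordinates.
Qed.
End Simplex.

(** * Hadamard's determinant inequality *)

Section Hadamard.
Variable F : realFieldType.

Definition psd n (A : 'M[F]_n) :=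
  A^T = A /\ forall x : 'rV_n, 0 <= (x *m A *m x^T) ord0 ord0.

Lemma qform_delta n (A : 'M[F]_n) i j a b :
  let x : 'rV_n := a *: delta_mx 0 i + b *: delta_mx 0 j in
  (x *m A *m x^T) ord0 ord0 =
    a ^+ 2 * A i i + a * b * (A i j + A j i) + b ^+ 2 * A j j.
Proof.
rewrite /= linearD/= !linearZ/= !trmx_delta mulmxDr !mulmxDl -!scalemxAr -!scalemxAl.
by rewrite -!rowE -!colE !mxE; ring.
Qed.

Lemma psd_diag_ge0 n (A : 'M[F]_n) i : psd A -> 0 <= A i i.
Proof.
case=> _ /(_ (1 *: delta_mx 0 i + 0 *: delta_mx 0 i)); rewrite qform_delta; lra.
Qed.

Lemma psd_diag0 n (A : 'M[F]_n) i j : psd A -> A i i = 0 -> A i j = 0.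
Proof.
move=> [As Ap] Ai0; apply/eqP/negPn/negP => Aij.
have Aji : A j i = A i j by rewrite -[in LHS]As mxE.
(* With [A i i = 0] the form is affine in the coefficient of the i-th vector; this choice gives it
   the value -1. *)
have := Ap (- (A j j + 1) / (2 * A i j) *: delta_mx 0 i + 1 *: delta_mx 0 j).
rewrite qform_delta Ai0 Aji.
have -> : - (A j j + 1) / (2 * A i j) * 1 * (A i j + A i j) = - (A j j + 1) by field.
lra.
Qed.

Lemma det_block_schur n (a : 'M[F]_1) (b : 'M_(1, n)) c (D : 'M_n) :
  a ord0 ord0 != 0 ->
  \det (block_mx a b c D) =
    a ord0 ord0 * \det (D - (a ord0 ord0)^-1 *: (c *m b)).
Proof.
move=> a0; set x := a ord0 ord0 in a0 *.
have : block_mx 1%:M 0 (- x^-1 *: c) 1%:M *m block_mx a b c D =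
    block_mx a b 0 (D - x^-1 *: (c *m b)).
  rewrite mulmx_block !mul1mx !mul0mx !addr0 [a]mx11_scalar -/x mul_mx_scalar.
  by rewrite scalerA mulrN divff// scaleN1r addNr -scalemxAl scaleNr addrC.
move/(congr1 determinant); rewrite det_mulmx det_lblock !det1 !mul1r => ->.
by rewrite det_ublock det_mx11.
Qed.

(** Extending x by the first coordinate - t^-1 x b^T annihilates the first block of the product, and
    the form of the block matrix becomes that of the Schur complement. *)
Lemma psd_schur n (a : 'M[F]_1) (b : 'M_(1, n)) (D : 'M_n) :
  a ord0 ord0 != 0 -> psd (block_mx a b b^T D) ->
  psd (D - (a ord0 ord0)^-1 *: (b^T *m b)).
Proof.
move=> a0 [Ms Mp]; set t := a ord0 ord0 in a0 *; split.
  have Ds : D^T = D by move: Ms; rewrite tr_block_mx => /eq_block_mx[].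
  by rewrite linearB/= linearZ/= trmx_mul trmxK Ds.
move=> x; have := Mp (row_mx (- t^-1 *: (x *m b^T)) x).
rewrite mul_row_block tr_row_mx mul_row_col [a]mx11_scalar -/t mul_mx_scalar.
rewrite scalerA mulrN divff// scaleN1r addNr mul0mx add0r.
by rewrite -scalemxAl -mulmxA scaleNr addrC scalemxAr -mulmxBr.
Qed.

(** Induction on the size. A zero pivot forces a zero first row; otherwise the Schur complement is
    again [psd], and passing to it only lowers the remaining diagonal entries. *)
Lemma psd_det_le_prod_diag n (A : 'M[F]_n) : psd A -> \det A <= \prod_i A i i.
Proof.
elim: n A => [|n IH] A Apsd; first by rewrite det_mx00 big_ord0.
have [A0|A0] := eqVneq (A ord0 ord0) 0.
  rewrite (expand_det_row _ ord0) big1 => [|j _]; last by rewrite psd_diag0// mul0r.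
  by rewrite big_ord_recl A0 mul0r.
have Agt0 : 0 < A ord0 ord0 by rewrite lt0r A0 psd_diag_ge0.
pose B : 'M_(1 + n) := A.
pose b := ursubmx B; pose D := drsubmx B; pose a := ulsubmx B.
have ea : a ord0 ord0 = A ord0 ord0 by rewrite !mxE; congr (A _ _); apply: val_inj.
have eB : B = block_mx a b b^T D.
  have [As _] := Apsd; rewrite /b trmx_ursub [B^T]As; exact/esym/submxK.
have a0 : a ord0 ord0 != 0 by rewrite ea.
have Spsd : psd (D - (a ord0 ord0)^-1 *: (b^T *m b)).
  by apply: psd_schur => //; rewrite -eB.
have -> : \det A = a ord0 ord0 * \det (D - (a ord0 ord0)^-1 *: (b^T *m b)).
  by rewrite -det_block_schur// -eB.
rewrite big_ord_recl -ea ler_pM2l ?ea// -ea (le_trans (IH _ Spsd))//.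
apply: ler_prod => i _; rewrite psd_diag_ge0//=.
rewrite !mxE big_ord1 -[leRHS]subr0.
have -> : rshift 1 i = lift ord0 i by exact: val_inj.
rewrite lerD2l lerN2 mulr_ge0//; last by rewrite !mxE -expr2 sqr_ge0.
by move: (ltW Agt0); rewrite -ea !mxE invr_ge0.
Qed.
End Hadamard.

(** * The Lagrange basis of the support points *)

Section Design.
Variables (R : realType) (k : nat).
Implicit Types (x u : 'rV[R]_k) (t s : idx k).

Lemma sum_pairlt (f : 'I_k -> 'I_k -> R) : (forall i j, f i j = f j i) ->
  \sum_(p : pairlt k) f (sval p).1 (sval p).2 =
  (\sum_i \sum_j f i j - \sum_i f i i) / 2.
Proof.
move=> fC.
have -> : \sum_(p : pairlt k) f (sval p).1 (sval p).2 =
    \sum_(i < k) \sum_(j < k | (i < j)%N) f i j.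
  rewrite pair_big_dep/= (big_sub [pred p : 'I_k * 'I_k | (p.1 < p.2)%N] (fun p => f p.1 p.2)).
  by [].
have -> : \sum_i \sum_j f i j =
    \sum_i f i i + (\sum_(i < k) \sum_(j < k | (i < j)%N) f i j) *+ 2.
  have e : \sum_(i < k) \sum_(j < k | (i < j)%N) f i j = \sum_(i < k) \sum_(j < k | (j < i)%N) f i j.
    by rewrite (exchange_big_dep xpredT)//=; apply: eq_bigr => i _; apply: eq_bigr => j _.
  rewrite mulr2n {1}e -!big_split/=; apply: eq_bigr => i _.
  rewrite (bigD1 i)//=; congr (_ + _); rewrite (bigID (fun j : 'I_k => (j < i)%N))/=.
  by congr (_ + _); apply: eq_bigl => j; rewrite -val_eqE/=; case: ltngtP.
by rewrite addrC addKr -mulr_natr; field.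
Qed.

Lemma sum_idx (f : idx k -> R) :
  \sum_t f t = f (inl (inl tt)) + \sum_i f (inl (inr i)) + \sum_p f (inr p).
Proof.
rewrite big_sumType/= big_sumType/=; congr (_ + _ + _).
by rewrite (big_pred1 tt)// => -[].
Qed.

Lemma sum_npar (f : idx k -> R) : \sum_(j < npar k) f (enum_val j) = \sum_t f t.
Proof. by rewrite -big_enum_val. Qed.

(** In these coordinates the support points are the 0/1 vectors with at most two ones. *)
Definition halved x := 2^-1 *: x.

(** The basis dual to evaluation at the settings. With S = [psum 1 u], the first function is 1 - S +
    E_2, where E_2 is expressed through power sums. *)
Definition lagrange x t : R :=
  let u := halved x in
  match t with
  | inl (inl _) => 1 - psum 1 u + (psum 1 u ^+ 2 - psum 2 u) / 2
  | inl (inr i) => u ord0 i * (1 - psum 1 u + u ord0 i)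
  | inr p => u ord0 (sval p).1 * u ord0 (sval p).2
  end.

Lemma halved_ge0 x : in_domain x -> forall i, 0 <= halved x ord0 i.
Proof. by move=> x0 i; rewrite mxE mulr_ge0 ?invr_ge0. Qed.

Lemma lam_beta5 x : lam (beta5 k) x = expR (- (2 * psum 1 (halved x))).
Proof.
rewrite /lam (eq_bigr (fun j : 'I_(npar k) => feat x (enum_val j) * beta_coef (enum_val j))); last first.
  by move=> j _; rewrite !mxE.
rewrite (sum_npar (fun t => feat x t * beta_coef t)) sum_idx/= mulr0 add0r.
rewrite [X in _ + X]big1 ?addr0; last by move=> p _; rewrite mulr0.
congr expR; rewrite /psum mulr_sumr -sumrN; apply: eq_bigr => i _.
by rewrite mulrN1 expr1 mxE mulVKf ?pnatr_eq0.
Qed.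

Definition setting_mass t : nat :=
  match t with
  | inl (inl _) => 0
  | inl (inr _) => 1
  | inr _ => 2
  end.

Lemma halved_setting t l : halved (setting (R:=R) t) ord0 l =
  match t with
  | inl (inl _) => 0
  | inl (inr i) => (l == i)%:R
  | inr p => (l == (sval p).1)%:R + (l == (sval p).2)%:R
  end.
Proof.
have h i : (if l == i then 1 else 0) = (l == i)%:R :> R by case: eqP.
case: t => [[[]|i]|p]; rewrite !mxE ?h ?mulr0// ?mulKf ?pnatr_eq0// -mulrDr mulKf ?pnatr_eq0//.
Qed.

Lemma sum_eq_mul (f : 'I_k -> R) i : \sum_l f l * (l == i)%:R = f i.
Proof.
by rewrite (bigD1 i)//= eqxx mulr1 big1 ?addr0// => l /negPf ->; rewrite mulr0.
Qed.

Lemma pairlt_neq (p : pairlt k) : (sval p).1 != (sval p).2.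
Proof. by case: p => -[a b] /= ab; rewrite -val_eqE neq_ltn ab. Qed.

(** Coordinates are 0 or 1, so all positive powers agree; [n.+1] avoids 0^0 = 1. *)
Lemma psum_setting n t :
  psum n.+1 (halved (setting (R:=R) t)) = (setting_mass t)%:R.
Proof.
rewrite /psum; under eq_bigr do rewrite halved_setting.
case: t => [[[]|i]|p]/=.
- by rewrite big1// => i _; rewrite expr0n.
- rewrite -[RHS](sum_eq_mul (fun=> 1) i); apply: eq_bigr => l _.
  by rewrite mul1r; case: eqP => _; rewrite ?expr1n ?expr0n.
- have pn := pairlt_neq p.
  rewrite -[RHS]/(1 + 1) -[X in X + _](sum_eq_mul (fun=> 1) (sval p).1).
  rewrite -[X in _ + X](sum_eq_mul (fun=> 1) (sval p).2) -big_split/=.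
  apply: eq_bigr => l _; rewrite !mul1r; case: eqP => [->|_].
    by rewrite (negPf pn) addr0 expr1n.
  by rewrite add0r; case: eqP => _; rewrite ?expr1n ?expr0n.
Qed.

Lemma lagrange_setting t s : lagrange (setting t) s = (s == t)%:R.
Proof.
case: s => [[[]|i]|q]; rewrite /lagrange ?psum_setting ?halved_setting.
- by case: t => [[[]|i]|p]/=; rewrite ?eqxx /=; [ring|field|field].
- case: t => [[[]|j]|p]/=; first by rewrite mul0r.
    rewrite subrr add0r; have [->|ij] := eqVneq i j; rewrite ?eqxx ?mulr1// mul0r.
    by case: eqP => // -[ij']; rewrite ij' eqxx in ij.
  have pn := negPf (pairlt_neq p).
  by case: eqP => [->|_]; rewrite ?pn; [|case: eqP => _]; rewrite /=; ring.
- case: t => [[[]|j]|p]/=; first by rewrite mul0r.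
    have qn := negPf (pairlt_neq q).
    by case: eqP => [<-|_]; rewrite 1?eq_sym ?qn ?mul0r ?mulr0.
  have -> : (inr q == inr p :> idx k) = (q == p) by [].
  have -> : (q == p) = ((sval q).1 == (sval p).1) && ((sval q).2 == (sval p).2).
    by rewrite -val_eqE/=.
  case: q p => -[a b] /= ab [[c d] /= cd].
  rewrite -!val_eqE/=; do 4 case: eqP => ?; rewrite /=; try ring; lia.
Qed.

(** Interpolation at the settings reproduces every regression function. Sums over pairs are
    completed to double sums by [sum_pairlt], where the indicators select the surviving terms. *)
Lemma feat_lagrange x s : feat x s = \sum_t lagrange x t * feat (setting t) s.
Proof.
set u := halved x.
have xE i : x ord0 i = 2 * u ord0 i by rewrite /u mxE mulVKf ?pnatr_eq0.
have sE t i : setting t ord0 i = 2 * halved (setting (R:=R) t) ord0 i.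
  by rewrite [in RHS]mxE mulVKf ?pnatr_eq0.
have u1 : \sum_i u ord0 i = psum 1 u by apply: eq_bigr => i _; rewrite expr1.
have u2 : \sum_i u ord0 i * u ord0 i = psum 2 u by apply: eq_bigr => i _; rewrite expr2.
case: s => [[[]|l]|q] /=.
- rewrite sum_idx/= -/u mulr1.
  under eq_bigr do rewrite mulr1 mulrDr.
  under [X in _ + X]eq_bigr do rewrite mulr1.
  rewrite (@sum_pairlt (fun a b => u ord0 a * u ord0 b)); last by move=> a b; rewrite mulrC.
  rewrite big_split/= -mulr_suml u1 u2 -big_distrlr/= u1; by field.
- rewrite xE; under eq_bigr do rewrite sE halved_setting.
  rewrite sum_idx/= !mulr0 add0r -/u.
  under eq_bigr do rewrite mulrCA eq_sym.
  rewrite -mulr_sumr sum_eq_mul.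
  rewrite (@sum_pairlt (fun a b => u ord0 a * u ord0 b * (2 * ((l == a)%:R + (l == b)%:R)))); last first.
    by move=> a b; rewrite [in LHS]mulrC (addrC (_ == a)%:R) [in RHS]mulrC (mulrC (u ord0 a)).
  have -> : \sum_i \sum_j u ord0 i * u ord0 j * (2 * ((l == i)%:R + (l == j)%:R)) =
      4 * (u ord0 l * psum 1 u).
    transitivity (\sum_i (2 * psum 1 u * (u ord0 i * (i == l)%:R) + 2 * u ord0 l * u ord0 i)).
      apply: eq_bigr => i _; rewrite -u1 mulr_sumr mulr_suml -(sum_eq_mul (fun j => u ord0 j) l).
      rewrite mulr_sumr mulr_suml -big_split/=; apply: eq_bigr => j _.
      by rewrite (eq_sym l i) (eq_sym l j); ring.
    by rewrite big_split/= -!mulr_sumr sum_eq_mul u1; ring.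
  have -> : \sum_i u ord0 i * u ord0 i * (2 * ((l == i)%:R + (l == i)%:R)) =
      4 * (u ord0 l) ^+ 2.
    transitivity (\sum_i 4 * (u ord0 i ^+ 2 * (i == l)%:R)).
      by apply: eq_bigr => i _; rewrite eq_sym; ring.
    by rewrite -mulr_sumr (sum_eq_mul (fun i => u ord0 i ^+ 2)).
  by field.
- set c := (sval q).1; set d := (sval q).2; have cd : c != d := pairlt_neq q.
  rewrite !xE; under eq_bigr do rewrite !sE !halved_setting.
  rewrite sum_idx/= !mulr0 add0r -/u.
  (* An interaction vanishes at a setting with a single nonzero coordinate. *)
  rewrite [X in X + _]big1 ?add0r; last first.
    move=> i _; case: (eqVneq c i) => [<-|_]; last by rewrite mulr0 mul0r mulr0.
    by rewrite eq_sym (negPf cd) !mulr0.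
  rewrite (@sum_pairlt (fun a b => u ord0 a * u ord0 b * (2 * ((c == a)%:R + (c == b)%:R) *
    (2 * ((d == a)%:R + (d == b)%:R))))); last by move=> a b; ring.
  rewrite [X in _ - X]big1 ?subr0; last first.
    move=> i _; case: (eqVneq c i) => [<-|_]; last by rewrite addr0 mulr0 mul0r mulr0.
    by rewrite eq_sym (negPf cd) addr0 !mulr0.
  transitivity ((4 * (\sum_i u ord0 i * (i == c)%:R) * (\sum_j u ord0 j * (j == d)%:R)
    + 4 * (\sum_i u ord0 i * (i == d)%:R) * (\sum_j u ord0 j * (j == c)%:R)) / 2).
    by rewrite !sum_eq_mul; field.
  congr (_ / 2); rewrite -!mulrA !big_distrlr/= !mulr_sumr -big_split/=; apply: eq_bigr => i _.
  rewrite !mulr_sumr -big_split/=; apply: eq_bigr => j _.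
  (* No index equals both c and d. Expansion leaves two such products, which are added as zeros to
     make a ring identity. *)
  have h e : (c == e)%:R * (d == e)%:R = 0 :> R.
    by case: (eqVneq c e) => [<-|_]; rewrite ?mul0r// eq_sym (negPf cd) mulr0.
  rewrite !(eq_sym _ c) !(eq_sym _ d).
  rewrite -[LHS]addr0 -(mulr0 (4 * u ord0 i * u ord0 j)) -(addr0 0) -{1}(h i) -(h j); ring.
Qed.

Lemma lam_setting_inv t :
  (lam (beta5 k) (setting t))^-1 = expR 1 ^+ (2 * setting_mass t) :> R.
Proof.
by rewrite lam_beta5 psum_setting -expRN opprK -natrM -[X in expR X]mulr1 expRM_natl.
Qed.

Lemma sum_lagrange_sqr x :
  \sum_t lagrange x t ^+ 2 / lam (beta5 k) (setting t) = sens (halved x).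
Proof.
set u := halved x; under eq_bigr do rewrite lam_setting_inv.
rewrite sum_idx/= muln0 muln1 expr0 mulr1 -/u -!mulr_suml /sens /sensitivity_poly.
congr (_ + _ + _).
  rewrite mulrC; congr (_ * _); rewrite /psum !mulr_sumr -!big_split/=.
  by apply: eq_bigr => i _; ring.
rewrite mulrC; congr (_ * _).
rewrite (@sum_pairlt (fun a b => (u ord0 a * u ord0 b) ^+ 2)); last by move=> a b; rewrite mulrC.
congr ((_ - _) / 2); last by apply: eq_bigr => i _; ring.
rewrite expr2 /psum big_distrlr/=; apply: eq_bigr => i _; apply: eq_bigr => j _.
by rewrite exprMn.
Qed.

(** The condition of the Kiefer-Wolfowitz equivalence theorem: p times the left side is lam f^T M^-1
    f, with M the information matrix of the candidate design. *)
Lemma lagrange_sqr_le x : in_domain x ->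
  lam (beta5 k) x * \sum_t lagrange x t ^+ 2 / lam (beta5 k) (setting t) <= 1.
Proof.
move=> x0; rewrite sum_lagrange_sqr lam_beta5 expRN mulrC ler_pdivrMr ?expR_gt0// mul1r.
by apply: sens_le; exact: halved_ge0.
Qed.

(** * Information matrices in the Lagrange basis and their determinants *)

Definition lagrange_vec x : 'rV[R]_(npar k) := \row_j lagrange x (enum_val j).

Definition setting_matrix : 'M[R]_(npar k) :=
  \matrix_(i, j) feat (setting (enum_val i)) (enum_val j).

Definition lagrange_gram n (Y : 'I_n -> 'rV[R]_k) (v : 'I_n -> R) : 'M[R]_(npar k) :=
  \sum_(i < n) (v i * lam (beta5 k) (Y i)) *: ((lagrange_vec (Y i))^T *m lagrange_vec (Y i)).

Lemma fvec_lagrange x : fvec x = lagrange_vec x *m setting_matrix.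
Proof.
apply/rowP => j; rewrite !mxE feat_lagrange.
rewrite -(sum_npar (fun t => lagrange x t * feat (setting t) (enum_val j))).
by apply: eq_bigr => i _; rewrite !mxE.
Qed.

Lemma infomat_gram n (Y : 'I_n -> 'rV[R]_k) v :
  infomat (beta5 k) Y v =
  setting_matrix^T *m lagrange_gram Y v *m setting_matrix.
Proof.
rewrite /infomat /lagrange_gram mulmx_sumr mulmx_suml; apply: eq_bigr => i _.
by rewrite fvec_lagrange trmx_mul -scalemxAr -scalemxAl !mulmxA.
Qed.

(** The change of basis contributes a square common to all designs, so it suffices to compare the
    determinants of [lagrange_gram]. *)
Lemma det_infomat n (Y : 'I_n -> 'rV[R]_k) v :
  \det (infomat (beta5 k) Y v) =
  \det setting_matrix ^+ 2 * \det (lagrange_gram Y v).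
Proof. by rewrite infomat_gram !det_mulmx det_tr; ring. Qed.

Lemma lagrange_gram_setting :
  lagrange_gram (X5 (R:=R) (k:=k)) (w5 (k:=k)) =
  diag_mx (\row_j ((npar k)%:R^-1 * lam (beta5 k) (X5 j))).
Proof.
rewrite diag_mx_sum_delta; apply: eq_bigr => j _; rewrite mxE; congr (_ *: _).
have -> : lagrange_vec (X5 j) = delta_mx ord0 j.
  apply/rowP => i; rewrite !mxE lagrange_setting (inj_eq enum_val_inj).
  by rewrite eqxx.
by rewrite trmx_delta mul_delta_mx.
Qed.

Lemma psd_lagrange_gram n (Y : 'I_n -> 'rV[R]_k) v :
  (forall i, 0 <= v i) -> psd (lagrange_gram Y v).
Proof.
move=> v0; split.
  rewrite /lagrange_gram linear_sum/=; apply: eq_bigr => i _.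
  by rewrite linearZ/= trmx_mul trmxK.
move=> x; rewrite mulmx_sumr mulmx_suml summxE; apply: sumr_ge0 => i _.
rewrite -scalemxAr -scalemxAl mxE mulr_ge0// ?mulr_ge0 ?expR_ge0//.
have gx : lagrange_vec (Y i) *m x^T = (x *m (lagrange_vec (Y i))^T)^T.
  by rewrite trmx_mul trmxK.
rewrite mulmxA -(mulmxA (x *m _)) gx.
by rewrite mxE big_ord1 [X in _ * X]mxE -expr2 sqr_ge0.
Qed.

Lemma lagrange_gram_diag n (Y : 'I_n -> 'rV[R]_k) v j :
  lagrange_gram Y v j j =
  \sum_(i < n) v i * lam (beta5 k) (Y i) * lagrange (Y i) (enum_val j) ^+ 2.
Proof.
rewrite summxE; apply: eq_bigr => i _.
by rewrite !mxE big_ord1 !mxE expr2.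
Qed.

Lemma det_lagrange_gram_le n (Y : 'I_n -> 'rV[R]_k) v : is_design Y v ->
  \det (lagrange_gram Y v) <=
  \det (lagrange_gram (X5 (R:=R) (k:=k)) (w5 (k:=k))).
Proof.
move=> [_ [Y0 [v0 v1]]]; apply: le_trans (psd_det_le_prod_diag (psd_lagrange_gram Y v0)) _.
rewrite lagrange_gram_setting det_diag.
pose l (j : 'I_(npar k)) := lam (beta5 k) (X5 (R:=R) j).
have l0 j : 0 < l j by exact: expR_gt0.
(* Diagonal entries relative to the intensities at the support points; for the candidate each ratio
   is 1 / p, the equality case of AM-GM under total 1. *)
pose E j := lagrange_gram Y v j j / l j.
have E0 j : 0 <= E j by rewrite divr_ge0 ?(ltW (l0 j))// psd_diag_ge0//; exact: psd_lagrange_gram.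
have -> : \prod_j lagrange_gram Y v j j = (\prod_j E j) * \prod_j l j.
  by rewrite -big_split/=; apply: eq_bigr => j _; rewrite divfK ?gt_eqF.
under [leRHS]eq_bigr do rewrite mxE.
rewrite [leRHS]big_split/= ler_pM2r; last by apply: prodr_gt0 => j _; exact: l0.
have := leif_AGM (A := predT) (fun j _ => E0 j).
move=> /leif_le/le_trans; apply.
rewrite prodr_const cardT size_enum_ord lerXn2r ?nnegrE ?divr_ge0 ?invr_ge0 ?sumr_ge0//.
rewrite -[leRHS]mul1r ler_wpM2r ?invr_ge0//.
(* Exchanging sums makes the total a weighted mean of the left sides of [lagrange_sqr_le], hence at
   most 1. *)
have -> : \sum_j E j = \sum_(i < n) v i * (lam (beta5 k) (Y i) *
    \sum_t lagrange (Y i) t ^+ 2 / lam (beta5 k) (setting t)).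
  rewrite (eq_bigr (fun j => \sum_(i < n) v i * lam (beta5 k) (Y i) *
      (lagrange (Y i) (enum_val j) ^+ 2 / lam (beta5 k) (setting (enum_val j))))).
    rewrite exchange_big/=; apply: eq_bigr => i _.
    by rewrite -mulr_sumr (sum_npar (fun t => lagrange (Y i) t ^+ 2 / lam (beta5 k) (setting t))) mulrA.
  move=> j _; rewrite /E lagrange_gram_diag mulr_suml; apply: eq_bigr => i _.
  by rewrite mulrA.
rewrite -v1; apply: ler_sum => i _; rewrite -[leRHS]mulr1 ler_wpM2l//.
exact: lagrange_sqr_le.
Qed.

(** The Lagrange functions separate the settings. *)
Lemma X5_inj : injective (@X5 R k).
Proof.
move=> i j /(congr1 (fun x => lagrange x (enum_val i))).
rewrite !lagrange_setting eqxx (inj_eq enum_val_inj); case: eqP => // _ /eqP.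
by rewrite oner_eq0.
Qed.

Lemma in_domain_X5 j : in_domain (@X5 R k j).
Proof.
move=> i; rewrite /X5; have := halved_setting (enum_val j) i.
rewrite mxE => /(canRL (mulVKf _)) ->; last by rewrite pnatr_eq0.
by case: (enum_val j) => [[[]|l]|p]; rewrite mulr_ge0 ?addr_ge0.
Qed.
End Design.

Theorem theorem5 (R : realType) (k : nat) (hk : (3 <= k)%N) :
  @locally_D_optimal R k (beta5 k) (npar k) (@X5 R k) (@w5 R k).
Proof.
split.
  split; first exact: X5_inj.
  split; first exact: in_domain_X5.
  split=> [i|]; first by rewrite invr_ge0.
  rewrite /w5 sumr_const card_ord -[_ *+ npar k]mulr_natl mulfV// pnatr_eq0 -lt0n.
  by apply/card_gt0P; exists (inl (inl tt)).
move=> m Y v Yv; rewrite !det_infomat ler_wpM2l ?sqr_ge0//.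
exact: det_lagrange_gram_le.
Qed.
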